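(* Let $D$ be a delta-matroid and $A$ a non-empty proper subset of $E(D)$. Write $A^c = E(D)-A$. Then the twist $D*A$ is a matroid if and only if the following two conditions hold: (1) $A$ is separating in the lower matroid $D_{\min}$; and (2) $D\setminus A$ and $D\setminus A^c$ are both matroids.
   Context: A set system is a pair $D=(E,\mathcal{F})$ where $E=E(D)$ is a finite set (the ground set) and $\mathcal{F}$ is a collection of subsets of $E$ (the feasible sets); it is proper if $\mathcal{F}\neq\emptyset$. A delta-matroid is a proper set system such that for all $X,Y\in\mathcal{F}$ and $u\in X\bigtriangleup Y$ there is $v\in X\bigtriangleup Y$ (possibly $v=u$) with $X\bigtriangleup\{u,v\}\in\mathcal{F}$, where $\bigtriangleup$ is symmetric difference. A delta-matroid is a matroid if all its feasible sets have the same cardinality; its feasible sets are then its bases. Twist: for $A\subseteq E$, $D*A=(E,\{A\bigtriangleup X: X\in\mathcal{F}\})$. Lower matroid: $D_{\min}=(E,\mathcal{F}_{\min})$, where $\mathcal{F}_{\min}$ is the set of feasible sets of minimum cardinality; it is a matroid. Deletion and contraction: $e\in E$ is a coloop of $D$ if it is in every feasible set, and a loop of $D$ if it is in no feasible set. If $e$ is not a coloop, $D\setminus e=(E-e,\{F: F\in\mathcal{F}, F\subseteq E-e\})$. If $e$ is not a loop, $D/e=(E-e,\{F-e: F\in\mathcal{F}, e\in F\})$. If $e$ is a loop or a coloop, then one of $D\setminus e$ and $D/e$ has been defined and one sets $D/e=D\setminus e$. $D\setminus A$ is obtained by deleting the elements of $A$ one at a time (the order is immaterial). Direct sum: for delta-matroids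 $D_1=(E_1,\mathcal{F}_1)$, $D_2=(E_2,\mathcal{F}_2)$ with $E_1\cap E_2=\emptyset$, $D_1\oplus D_2=(E_1\cup E_2,\{F_1\cup F_2: F_1\in\mathcal{F}_1, F_2\in\mathcal{F}_2\})$. If $D=D_1\oplus D_2$ with both ground sets non-empty, then $E(D_1)$ and $E(D_2)$ are called separating in $D$. *)

(* Defs.v *)
From HB Require Import structures.
From mathcomp Require Import all_boot.

Set Implicit Arguments.
Unset Strict Implicit.
Unset Printing Implicit Defensive.

(* Ground sets are finite sets {set T} rather than whole finite types, since
   deletion and direct sum change the ground set.  That feasible sets are
   subsets of the ground set is the predicate [well_formed], which is part of
   [delta_matroid]. *)
Record set_system (T : finType) := SetSystem {
  ground : {set T};
  feasible : {set {set T}}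
}.

Definition symdiff (T : finType) (X Y : {set T}) : {set T} :=
  (X :\: Y) :|: (Y :\: X).

Section SetSystems.
Variable T : finType.
Implicit Types (D : set_system T) (A X Y : {set T}) (e u v : T).

Definition well_formed D : Prop :=
  forall X, X \in feasible D -> X \subset ground D.

Definition proper_system D : Prop := feasible D != set0.

(* [set u; v] is [set u] when v = u. *)
Definition symmetric_exchange D : Prop :=
  forall X Y, X \in feasible D -> Y \in feasible D ->
  forall u, u \in symdiff X Y ->
  exists2 v, v \in symdiff X Y & symdiff X [set u; v] \in feasible D.

Definition delta_matroid D : Prop :=
  [/\ well_formed D, proper_system D & symmetric_exchange D].

Definition matroid D : Prop :=
  delta_matroid D /\
  forall X Y, X \in feasible D -> Y \in feasible D -> #|X| = #|Y|.

Definition twist D A : set_system T :=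
  SetSystem (ground D) [set symdiff A X | X in feasible D].

Definition lower_matroid D : set_system T :=
  SetSystem (ground D)
    [set X in feasible D | [forall Y in feasible D, #|X| <= #|Y|]].

Definition coloop D e : bool := [forall X in feasible D, e \in X].

Definition delete_noncoloop D e : set_system T :=
  SetSystem (ground D :\ e)
    [set X in feasible D | X \subset ground D :\ e].

Definition contract_nonloop D e : set_system T :=
  SetSystem (ground D :\ e) [set X :\ e | X in feasible D & e \in X].

(* A coloop of a proper set system is not a loop, so D / e is then given by
   the non-loop formula, and D \ e is set equal to it. *)
Definition delete D e : set_system T :=
  if coloop D e then contract_nonloop D e else delete_noncoloop D e.

(* The elements of A are deleted in the order of [enum A]; on a delta-matroid
   with A included in the ground set, every order gives the same result. *)
Definition delete_set D A : set_system T := foldl delete D (enum A).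

Definition direct_sum D1 D2 : set_system T :=
  SetSystem (ground D1 :|: ground D2)
    [set X1 :|: X2 | X1 in feasible D1, X2 in feasible D2].

Definition separating D A : Prop :=
  exists D1 D2,
    [/\ delta_matroid D1 /\ delta_matroid D2,
        [disjoint ground D1 & ground D2],
        ground D1 != set0 /\ ground D2 != set0,
        D = direct_sum D1 D2 &
        A = ground D1 \/ A = ground D2].

End SetSystems.

(* Main.v *)
Require Import Defs.
From mathcomp Require Import all_boot zify.

Set Implicit Arguments.
Unset Strict Implicit.
Unset Printing Implicit Defensive.

(** Twisting by [A] changes the size of a feasible set [X] from [#|X|] to
    [#|A| + #|X :\: A| - #|X :&: A|], so the twist is a matroid exactly when the
    excess [#|X :\: A| - #|X :&: A|] is the same for all feasible sets
    ([twist_matroid]).  The theorem compares this single condition with three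
    local ones.

    The tool throughout is to look at feasible sets [X] whose trace [X :&: S] on
    a fixed set [S] is as small as possible.  Exchanging an element of [X :&: S]
    against any feasible [Y] must bring back an element of [S], since otherwise
    the trace would shrink; repeating this pushes the trace of [X] inside [Y]
    without touching [X] outside [S] ([minimal_on_glue]).  Three instances carry
    the proof.
    - With [S] everything, every feasible set contains a basis of the lower
      matroid.
    - With [S] a set of deleted elements, iterated deletion of [S] produces the
      sets [X :\: S] for [X] minimal on [S], whatever the order
      ([delete_set_erase]).
    - In the lower matroid, if all traces on [A] have the same size, the
      inside of one basis can be glued to the outside of another, so that [A]
      is separating ([separatingP]).

    If the excess is constant, the lower bases have constant size and constant
    excess, hence traces of constant size; and the sets minimal on [A] (or on
    its complement) have traces of equal size there, hence also elsewhere.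

    Conversely, let all lower bases have [a] elements in [A] and [b] outside.
    The deletions being matroids means that a feasible set with [a] elements in
    [A] has [b] outside, and vice versa.  Let [X] be a feasible set of any size,
    containing a lower basis [M].  Exchanging an element [u] of [X :\: M] towards
    [M] removes one or two elements of [X], including [u], and by induction on
    size the result has excess [b - a].  If [u] is in [A] at least half of what
    was removed lies in [A], so the excess of [X] is at most [b - a]; if [u] is
    outside [A] it is at least [b - a]; and if [X :\: M] misses one of the
    two sides, [X] and [M] agree there and the deletion hypothesis applies
    ([excess_const]). *)

(** * Symmetric differences *)

Section DeltaMatroids.
Variable T : finType.
Implicit Types (D L : set_system T) (E A S R X Y Z : {set T}) (e u v x : T).

Lemma in_symdiff X Y x : (x \in symdiff X Y) = (x \in X) (+) (x \in Y).
Proof. by rewrite !inE; case: (x \in X); case: (x \in Y). Qed.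

Lemma card_symdiff_pair X u v :
  u \in X -> v \in X -> #|symdiff X [set u; v]| < #|X|.
Proof.
move=> uX vX; apply: proper_card; apply/properP; split; last first.
  by exists u => //; rewrite in_symdiff uX !inE eqxx.
apply/subsetP=> x; rewrite in_symdiff !inE.
by case: eqP => [->|_]; case: eqP => [->|_]; rewrite ?uX ?vX ?addbF.
Qed.

Lemma symdiff_swap X u v :
  u \in X -> v \notin X -> symdiff X [set u; v] = v |: X :\ u.
Proof.
move=> uX vX; apply/setP=> x; rewrite in_symdiff !inE.
case: (x =P v) => [->|_]; first by rewrite (negbTE vX) orbT.
by case: eqP => [->|_]; rewrite ?uX ?addbF.
Qed.

(** * Feasible sets with a smallest trace *)

Definition minimal_on D S X : bool :=
  (X \in feasible D) && [forall Y in feasible D, #|X :&: S| <= #|Y :&: S|].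

Lemma minimal_onP D S X :
  reflect (X \in feasible D /\
           forall Y, Y \in feasible D -> #|X :&: S| <= #|Y :&: S|)
          (minimal_on D S X).
Proof.
apply: (iffP andP) => -[XD le_X]; split=> //; first exact/forall_inP.
exact/forall_inP.
Qed.

Lemma minimal_on_exists D S : proper_system D -> exists X, minimal_on D S X.
Proof.
case/set0Pn=> X0 X0D.
case: (arg_minnP (fun X : {set T} => #|X :&: S|) X0D) => X XD le_X.
by exists X; apply/minimal_onP.
Qed.

Lemma minimal_on_card D S X Y :
  minimal_on D S X -> minimal_on D S Y -> #|X :&: S| = #|Y :&: S|.
Proof.
case/minimal_onP=> XD le_X /minimal_onP[YD le_Y].
by apply/eqP; rewrite eqn_leq le_X ?le_Y.
Qed.

Lemma minimal_on_eq D S X Y :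
  minimal_on D S X -> Y \in feasible D -> #|Y :&: S| <= #|X :&: S| ->
  minimal_on D S Y.
Proof.
case/minimal_onP=> XD le_X YD leYX; apply/minimal_onP; split=> // Z ZD.
exact: leq_trans leYX (le_X _ ZD).
Qed.

(** If the exchanged [v] were in [X] or outside [S], nothing would replace [u] in
    the trace of [X] on [S], which would then be smaller than the minimum. *)
Lemma minimal_on_exchange D S X Y u :
  symmetric_exchange D -> minimal_on D S X -> Y \in feasible D ->
  u \in X -> u \notin Y -> u \in S ->
  exists v, [/\ v \in Y, v \notin X, v \in S & minimal_on D S (v |: X :\ u)].
Proof.
move=> exD minX YD uX uY uS; have [XD le_X] := minimal_onP _ _ _ minX.
have uXY : u \in symdiff X Y by rewrite in_symdiff uX (negbTE uY).
have [v vXY ZD] := exD _ _ XD YD _ uXY.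
(* Otherwise the new trace is inside [X :&: S :\ u]; this includes [v = u]. *)
have /andP[vX vS] : (v \notin X) && (v \in S).
  apply: contraLR (le_X _ ZD); rewrite negb_and negbK -ltnNge => vXS.
  apply: proper_card; apply/properP; split; last first.
    by exists u; rewrite inE ?uX // in_symdiff uX !inE eqxx.
  apply/subsetP=> x; rewrite !in_setI in_symdiff !inE.
  case xS: (x \in S); rewrite ?andbF // !andbT.
  case: eqP => [->|_]; first by rewrite uX.
  case: eqP => [xv|_]; last by rewrite addbF.
  by move: vXS; rewrite -xv xS orbF => ->.
have vY : v \in Y by move: vXY; rewrite in_symdiff (negbTE vX).
rewrite symdiff_swap // in ZD.
exists v; split=> //; apply: minimal_on_eq minX ZD _.
rewrite setIUl setIDAC (setIidPl _) ?sub1set //.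
by rewrite cardsU1 !inE (negbTE vX) !andbF (cardsD1 u (X :&: S)) inE uX uS.
Qed.

(** Each exchange towards [Y] replaces an element of [X :&: S] outside [Y] by an
    element of [Y] in [S], so that [X] changes only inside [S] and its trace
    eventually falls within [Y]. *)
Lemma minimal_on_glue D S X Y :
  symmetric_exchange D -> minimal_on D S X -> Y \in feasible D ->
  exists Z, [/\ minimal_on D S Z, Z :\: S = X :\: S & Z :&: S \subset Y].
Proof.
move=> exD + YD.
have [n] := ubnP #|(X :&: S) :\: Y|; elim: n X => // n IHn X leXn minX.
have [sub | /subsetPn[u]] := boolP (X :&: S \subset Y); first by exists X.
rewrite inE => /andP[uX uS] uY.
have [v [vY vX vS minZ]] := minimal_on_exchange exD minX YD uX uY uS.
have [|Z [minZ' eZ subZ]] := IHn _ _ minZ; last first.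
  exists Z; split=> //; rewrite eZ; apply/setP=> x; rewrite !inE.
  case xS: (x \in S) => //=.
  have /negbTE-> : x != v by apply: contraFneq xS => ->.
  by have /negbTE-> : x != u by apply: contraFneq xS => ->.
rewrite -ltnS; apply: leq_trans leXn; rewrite ltnS; apply: proper_card.
apply/properP; split; last first.
  exists u; rewrite !inE ?uX ?uY ?uS // eqxx.
  by case: eqP vX => //= <-; rewrite uX.
apply/subsetP=> x; rewrite !inE; case: (x =P v) => [->|_]; first by rewrite vY.
by case/and3P=> -> /andP[_ ->] ->.
Qed.

Lemma minimal_on_glue_eq D S X Y :
  symmetric_exchange D -> minimal_on D S X -> minimal_on D S Y ->
  minimal_on D S ((X :\: S) :|: (Y :&: S)).
Proof.
move=> exD minX minY; have [YD _] := minimal_onP _ _ _ minY.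
have [Z [minZ eZ subZ]] := minimal_on_glue exD minX YD.
suff <- : Z :&: S = Y :&: S by rewrite -eZ setUC setID.
apply/eqP; rewrite eqEcard (minimal_on_card minY minZ) leqnn andbT.
by rewrite subsetI subZ subsetIr.
Qed.

(** * Deletion of a set of elements *)

(** The closed form of the deletion of [S]: it is [delete_set D S] for a
    delta-matroid ([delete_set_erase]), but no order on [S] is involved. *)
Definition erase D S : set_system T :=
  SetSystem (ground D :\: S) [set X :\: S | X in minimal_on D S].

(** Two members of [erase D S] come from feasible sets which, after gluing, agree
    on [S]; an exchange between those happens entirely outside [S]. *)
Lemma erase_delta_matroid D S : delta_matroid D -> delta_matroid (erase D S).
Proof.
move=> [wfD prD exD]; split.
- move=> _ /imsetP[X minX ->]; apply: setSD; apply: wfD.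
  by case/minimal_onP: minX.
- have [X minX] := minimal_on_exists S prD.
  by apply/set0Pn; exists (X :\: S); apply: imset_f.
move=> _ _ /imsetP[X minX ->] /imsetP[Y minY ->] u.
have minZ := minimal_on_glue_eq exD minX minY.
set Z := _ :|: _ in minZ.
have [[ZD _] [YD _]] := (minimal_onP _ _ _ minZ, minimal_onP _ _ _ minY).
have eZY : symdiff Z Y = symdiff (X :\: S) (Y :\: S).
  apply/setP=> x; rewrite !in_symdiff !inE.
  by case: (x \in S); rewrite /= ?andbF ?andbT ?orbF ?addbb.
rewrite -eZY => uZY; have [v vZY WD] := exD _ _ ZD YD _ uZY.
exists v => //; apply/imsetP.
have notS x : x \in symdiff Z Y -> x \notin S.
  by rewrite eZY in_symdiff !inE; case: (x \in S).
have [uS vS] := (notS _ uZY, notS _ vZY).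
have xuv x : x \in S -> x \in [set u; v] = false.
  by move=> xS; rewrite !inE; apply/norP; split; apply: contraTneq xS => ->.
exists (symdiff Z [set u; v]).
  apply: (minimal_on_eq minZ WD); apply: subset_leq_card.
  apply/subsetP=> x; rewrite in_setI in_symdiff => /andP[+ xS].
  by rewrite (xuv _ xS) addbF in_setI xS andbT.
apply/setP=> x; rewrite in_symdiff !in_setD in_symdiff.
case xS: (x \in S); first by rewrite (xuv _ xS).
by rewrite [x \in Z]inE !in_setD in_setI xS andbF orbF.
Qed.

Lemma card_split S R X : #|X :&: (S :|: R)| = #|X :&: S| + #|(X :\: S) :&: R|.
Proof.
rewrite -(cardsID S (X :&: _)); congr (_ + _); apply: eq_card => x.
all: by rewrite !inE; case: (x \in S); rewrite ?andbF ?andbT.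
Qed.

(** Gluing a set minimal on [S :|: R] with one minimal on [S] gives a set that is
    minimal on both.  Hence minimizing the trace on [S], then on [R], minimizes
    the trace on the union, and no set is lost outside [S :|: R]. *)
Lemma erase_erase D S R :
  delta_matroid D -> erase (erase D S) R = erase D (S :|: R).
Proof.
move=> [wfD prD exD]; rewrite /erase /= setDDl; congr SetSystem.
have descend X : minimal_on D (S :|: R) X -> 
    exists Z, [/\ minimal_on D S Z, minimal_on D (S :|: R) Z
                & Z :\: (S :|: R) = X :\: (S :|: R)].
  move=> minX; have [Y minY] := minimal_on_exists S prD.
  have [YD _] := minimal_onP _ _ _ minY.
  have [Z [minZ eZ subZ]] := minimal_on_glue exD minX YD.
  have [ZD _] := minimal_onP _ _ _ minZ.
  exists Z; split=> //; apply: (minimal_on_eq minY ZD); apply: subset_leq_card.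
  rewrite subsetI subsetIr andbT; apply: subset_trans subZ.
  by rewrite setIS // subsetUl.
apply/setP=> W; apply/imsetP/imsetP=> [[W' minW' ->]|[X minX ->]].
  have [/imsetP[Y minY eY] le_W'] := minimal_onP _ _ _ minW'; subst W'.
  exists Y; last by rewrite setDDl.
  have [X minX] := minimal_on_exists (S :|: R) prD.
  have [Z [minZ minZ' _]] := descend X minX.
  have [YD _] := minimal_onP _ _ _ minY.
  apply: (minimal_on_eq minZ' YD); rewrite !card_split.
  by rewrite (minimal_on_card minY minZ) leq_add2l; apply: le_W'; apply: imset_f.
have [Z [minZ minZ' <-]] := descend X minX.
exists (Z :\: S); last by rewrite setDDl.
apply/minimal_onP; split; first exact: imset_f.
move=> _ /imsetP[Y minY ->]; have [YD _] := minimal_onP _ _ _ minY.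
have [_ /(_ _ YD)] := minimal_onP _ _ _ minZ'.
by rewrite !card_split (minimal_on_card minY minZ) leq_add2l.
Qed.

Lemma erase0 D : erase D set0 = D.
Proof.
case: D => E F; rewrite /erase /= setD0; congr SetSystem.
apply/setP=> X; apply/imsetP/idP=> [[Y /minimal_onP[YF _] ->]|XF].
  by rewrite setD0.
exists X; rewrite ?setD0 //; apply/minimal_onP; split=> // Y _.
by rewrite setI0 cards0.
Qed.

Lemma cardI1 X e : #|X :&: [set e]| = (e \in X).
Proof.
case: (boolP (e \in X)) => eX; first by rewrite (setIidPr _) ?sub1set ?cards1.
by apply/eqP; rewrite cards_eq0 setIC setI_eq0 disjoints1.
Qed.

(** A trace on [[set e]] has size 0 or 1.  The minimum is 1 exactly for a coloop,
    and this is the case distinction made by [delete]. *)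
Lemma delete_erase D e : well_formed D -> delete D e = erase D [set e].
Proof.
move=> wfD; rewrite /delete /coloop; case: ifPn => [/forall_inP all_e|].
  rewrite /contract_nonloop /erase; congr SetSystem.
  apply/setP=> W; apply/imsetP/imsetP=> -[X minX ->]; exists X => //.
    apply/minimal_onP; move: minX; rewrite inE => /andP[XD eX]; split=> // Y YD.
    by rewrite !cardI1 (all_e Y) ?leq_b1.
  by rewrite inE; case/minimal_onP: minX => XD _; rewrite XD all_e.
case/forall_inPn=> Y0 Y0D eY0.
rewrite /delete_noncoloop /erase; congr SetSystem.
apply/setP=> X; rewrite inE; apply/andP/imsetP=> [[XD subX]|[Y]].
  have eX : e \notin X.
    by apply/negP=> /(subsetP subX); rewrite !inE eqxx.
  exists X; last first.
    by apply/setP=> x; rewrite !inE; case: eqP => // ->; apply: negbTE.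
  by apply/minimal_onP; split=> // Y _; rewrite !cardI1 (negbTE eX).
case/minimal_onP=> YD /(_ _ Y0D); rewrite !cardI1 (negbTE eY0) => eY ->.
have -> : Y :\: [set e] = Y.
  by apply/setP=> x; rewrite !inE; case: eqP => // ->; case: (e \in Y) eY.
split=> //; apply/subsetP=> x xY; rewrite !inE (subsetP (wfD _ YD)) // andbT.
by apply: contraTneq eY => <-; rewrite xY.
Qed.

Lemma delete_set_erase D A : delta_matroid D -> delete_set D A = erase D A.
Proof.
move=> dmD; rewrite /delete_set -[A in RHS]set_enum.
elim: (enum A) D dmD => [|e s IHs] D dmD /=.
  by rewrite set_nil erase0.
have [wfD _ _] := dmD.
rewrite delete_erase // IHs; last exact: erase_delta_matroid.
by rewrite erase_erase // set_cons.
Qed.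

Lemma erase_matroid D S : delta_matroid D ->
  matroid (erase D S) <->
  (forall X Y, minimal_on D S X -> minimal_on D S Y -> #|X :\: S| = #|Y :\: S|).
Proof.
move=> dmD; split=> [[_ eq_card] X Y minX minY | eq_card].
  by apply: eq_card; apply: imset_f.
split; first exact: erase_delta_matroid.
by move=> _ _ /imsetP[X minX ->] /imsetP[Y minY ->]; apply: eq_card.
Qed.

(** * The lower matroid *)

Lemma lower_feasible D X :
  (X \in feasible (lower_matroid D)) = minimal_on D setT X.
Proof.
rewrite inE /minimal_on; congr (_ && _); apply: eq_forallb => Y.
by rewrite !setIT.
Qed.

Lemma lower_sub_feasible D X :
  X \in feasible (lower_matroid D) -> X \in feasible D.
Proof. by rewrite lower_feasible => /minimal_onP[]. Qed.

Lemma lower_contained D X : delta_matroid D -> X \in feasible D ->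
  exists2 M, M \in feasible (lower_matroid D) & M \subset X.
Proof.
move=> [_ prD exD] XD; have [M0 minM0] := minimal_on_exists setT prD.
have [M [minM _]] := minimal_on_glue exD minM0 XD; rewrite setIT => subM.
by exists M; rewrite ?lower_feasible.
Qed.

(** The dual exchange property of matroid bases.  Exchanging an element of
    [Y :\: X] other than [u] towards [X] keeps [u] and the common part of [X] and
    [Y], and reduces [Y :\: X] until [u] is its only element.  Then [Y] itself is
    the basis sought. *)
Lemma lower_up_exchange D X Y u :
  symmetric_exchange D -> minimal_on D setT X -> minimal_on D setT Y ->
  u \in Y -> u \notin X ->
  exists v, [/\ v \in X, v \notin Y & minimal_on D setT (u |: X :\ v)].
Proof.
move=> exD minX + uY uX.
have [XD _] := minimal_onP _ _ _ minX.
have [n] := ubnP #|Y :\: X|; elim: n Y uY => // n IHn Y uY leYn minY.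
have [] := boolP (Y :\: X \subset [set u]) => [sub | /subsetPn[x]].
  have eYX : Y :\: X = [set u].
    by apply/eqP; rewrite eqEsubset sub sub1set inE uX uY.
  have := minimal_on_card minX minY; rewrite !setIT.
  rewrite -(cardsID Y X) -(cardsID X Y) eYX cards1 setIC => /addnI/eqP.
  case/cards1P=> v eXY; exists v.
  have : v \in X :\: Y by rewrite eXY set11.
  rewrite inE => /andP[vY vX]; split=> //; suff -> : u |: X :\ v = Y by [].
  apply/setP=> z; move/setP/(_ z): eYX; move/setP/(_ z): eXY; rewrite !inE.
  by do 2 case: eqP => _; case: (z \in X); case: (z \in Y).
rewrite !inE => /andP[xX xY] xu.
have [v [vX vY _ minZ]] := minimal_on_exchange exD minY XD xY xX (in_setT x).
have [||w [wX wZ minW]] := IHn _ _ _ minZ.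
- by rewrite !inE [u == x]eq_sym xu uY orbT.
- rewrite -ltnS; apply: leq_trans leYn; rewrite ltnS.
  apply: proper_card; apply/properP.
  split; last first.
    exists x; rewrite !inE ?xX ?xY // eqxx /= orbF.
    by apply: contraNneq vY => <-.
  apply/subsetP=> z; rewrite !inE; case: (z =P v) => [->|_]; first by rewrite vX.
  by case/and3P=> -> _ ->.
exists w; split=> //; apply: contra wZ => wY; rewrite !inE wY andbT.
by apply/orP; right; apply: contraNneq xX => <-.
Qed.

Lemma lower_delta_matroid D :
  delta_matroid D -> delta_matroid (lower_matroid D).
Proof.
move=> [wfD prD exD]; split.
- by move=> X; rewrite lower_feasible => /minimal_onP[/wfD].
- have [X minX] := minimal_on_exists setT prD.
  by apply/set0Pn; exists X; rewrite lower_feasible.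
move=> X Y; rewrite !lower_feasible => minX minY u; rewrite in_symdiff.
case: (boolP (u \in X)) => uX /= uY.
  have [YD _] := minimal_onP _ _ _ minY.
  have [v [vY vX _ minZ]] :=
    minimal_on_exchange exD minX YD uX uY (in_setT u).
  exists v; first by rewrite in_symdiff vY (negbTE vX).
  by rewrite lower_feasible symdiff_swap.
have [v [vX vY minZ]] := lower_up_exchange exD minX minY uY uX.
exists v; first by rewrite in_symdiff vX.
by rewrite lower_feasible setUC symdiff_swap.
Qed.

Lemma lower_card D X Y :
  X \in feasible (lower_matroid D) -> Y \in feasible (lower_matroid D) ->
  #|X| = #|Y|.
Proof.
by rewrite !lower_feasible => minX /(minimal_on_card minX); rewrite !setIT.
Qed.

(** * Separating sets of a matroid *)

Lemma setI_compl E A X : X \subset E -> X :&: (E :\: A) = X :\: A.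
Proof. by move=> subX; rewrite setIDA (setIidPl subX). Qed.

Lemma setD_compl E A X : X \subset E -> X :\: (E :\: A) = X :&: A.
Proof.
move=> subX; rewrite setDDr (_ : X :\: E = set0) ?set0U //.
by apply/eqP; rewrite setD_eq0.
Qed.

(** In a direct sum of set systems with equicardinal feasible sets, replacing the
    first component changes the total size by the difference in the first
    component, so these are equicardinal too.  In the other direction, the two
    summands are the two restrictions, and gluing makes every combination of an
    inside with an outside feasible. *)
Lemma separatingP L A :
  delta_matroid L -> A != set0 -> A \proper ground L ->
  (forall X Y, X \in feasible L -> Y \in feasible L -> #|X| = #|Y|) ->
  separating L A <->
  (forall X Y, X \in feasible L -> Y \in feasible L -> #|X :&: A| = #|Y :&: A|).
Proof.
move=> dmL A0 prA eq_card; have [wfL _ exL] := dmL; split.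
  case=> D1 [D2 [[dm1 dm2] dis _ eL eA]].
  wlog -> : D1 D2 dm1 dm2 dis eL eA / A = ground D1.
    move=> base; case: (eA) => eA'; first exact: (base D1 D2).
    apply: (base D2 D1) => //; [by rewrite disjoint_sym | | by left].
    rewrite eL /direct_sum setUC; congr SetSystem.
    by apply/setP=> X; apply/imset2P/imset2P=> -[X1 X2 h1 h2 ->];
      exists X2 X1; rewrite // setUC.
  have [[wf1 _ _] [wf2 _ _]] := (dm1, dm2).
  have meet X1 X2 : X1 \in feasible D1 -> X2 \in feasible D2 ->
      (X1 :|: X2) :&: ground D1 = X1 /\ #|X1 :|: X2| = #|X1| + #|X2|.
    move=> /wf1 s1 /wf2 s2; split.
      rewrite setIUl (setIidPl s1); apply/setUidPl.
      suff /eqP -> : X2 :&: ground D1 == set0 by apply: sub0set.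
      by rewrite setI_eq0 disjoint_sym (disjointWr s2).
    rewrite cardsU (_ : X1 :&: X2 = set0) ?cards0 ?subn0 //.
    by apply/eqP; rewrite setI_eq0 (disjointW s1 s2).
  move=> X Y; rewrite eL => /imset2P[X1 X2 h1 h2 ->] /imset2P[Y1 Y2 k1 k2 ->].
  have [-> _] := meet _ _ h1 h2; have [-> _] := meet _ _ k1 k2.
  have inL Z1 Z2 : Z1 \in feasible D1 -> Z2 \in feasible D2 ->
      Z1 :|: Z2 \in feasible L by move=> *; rewrite eL; apply: imset2_f.
  have := eq_card _ _ (inL _ _ h1 h2) (inL _ _ k1 h2).
  by rewrite (meet _ _ h1 h2).2 (meet _ _ k1 h2).2 => /addIn.
move=> eq_A; have minA X : X \in feasible L -> minimal_on L A X.
  by move=> XL; apply/minimal_onP; split=> // Y YL; rewrite (eq_A X Y).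
have minAc X : X \in feasible L -> minimal_on L (ground L :\: A) X.
  move=> XL; apply/minimal_onP; split=> // Y YL.
  rewrite !setI_compl ?wfL //; have := eq_card _ _ XL YL.
  by rewrite -(cardsID A X) -(cardsID A Y) (eq_A X Y) // => /addnI ->.
have subA := proper_sub prA.
have eA : ground L :\: (ground L :\: A) = A.
  by rewrite setD_compl // (setIidPr subA).
exists (erase L (ground L :\: A)), (erase L A); split=> /=.
- by split; apply: erase_delta_matroid.
- by rewrite eA -setI_eq0 setIDA setDIl setDv set0I.
- by rewrite eA; split=> //; rewrite setD_eq0; case/andP: prA.
- case: L {dmL A0 prA eq_card eq_A} wfL exL minA minAc subA eA => E F /=.
  move=> wfL exL minA minAc subA eA.
  rewrite /direct_sum /= eA -{1}(setID E A) (setIidPr subA); congr SetSystem.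
  apply/setP=> X; apply/idP/imset2P=> [XL | [X1 X2]].
    exists (X :\: (E :\: A)) (X :\: A).
    - by apply: imset_f; apply: minAc.
    - by apply: imset_f; apply: minA.
    by rewrite setD_compl ?setID //; apply: (wfL X).
  case/imsetP=> Y minY -> /imsetP[Z minZ ->] ->.
  have [YL _] := minimal_onP _ _ _ minY; have [ZL _] := minimal_onP _ _ _ minZ.
  rewrite setD_compl ?(wfL Y) // setUC.
  by case/minimal_onP: (minimal_on_glue_eq exL minZ (minA _ YL)).
- by left; rewrite eA.
Qed.

(** * Twists and the excess over A *)

Lemma twist_delta_matroid D A :
  A \subset ground D -> delta_matroid D -> delta_matroid (twist D A).
Proof.
move=> subA [wfD prD exD]; split.
- move=> _ /imsetP[X XD ->] /=; apply/subsetP=> x; rewrite in_symdiff.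
  move/subsetP/(_ x): subA; move/subsetP/(_ x): (wfD _ XD).
  by case: (x \in A) => /= XE AE xAX; [apply: AE | apply: XE].
- case/set0Pn: prD => X XD; apply/set0Pn; exists (symdiff A X).
  exact: imset_f.
move=> _ _ /imsetP[X XD ->] /imsetP[Y YD ->] u.
have -> : symdiff (symdiff A X) (symdiff A Y) = symdiff X Y.
  by apply/setP=> x; rewrite !in_symdiff addbACA addbb.
case/(exD _ _ XD YD)=> v vXY ZD; exists v => //; apply/imsetP.
exists (symdiff X [set u; v]) => //.
by apply/setP=> x; rewrite !in_symdiff addbA.
Qed.

(** Equality of the differences [#|X :\: A| - #|X :&: A|] for [X] and [Y], written
    additively to avoid truncated subtraction. *)
Definition same_excess A X Y :=
  #|X :\: A| + #|Y :&: A| = #|Y :\: A| + #|X :&: A|.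

Lemma card_twist A X : #|symdiff A X| + #|X :&: A| = #|X :\: A| + #|A|.
Proof.
rewrite -(cardsID X A) setIC -(cardsID X (symdiff A X)).
suff -> : symdiff A X :&: X = X :\: A.
  suff -> : symdiff A X :\: X = A :\: X by lia.
  by apply/setP=> x; rewrite !inE; case: (x \in X); rewrite ?andbF ?orbF.
by apply/setP=> x; rewrite !inE; case: (x \in X); rewrite ?andbF ?andbT ?orbF.
Qed.

Lemma twist_matroid D A : delta_matroid D -> A \subset ground D ->
  matroid (twist D A) <->
  (forall X Y, X \in feasible D -> Y \in feasible D -> same_excess A X Y).
Proof.
move=> dmD subA; split=> [[_ eq_card] X Y XD YD | excD].
  have := eq_card _ _ (imset_f _ XD) (imset_f _ YD).
  by have := card_twist A X; have := card_twist A Y; rewrite /same_excess; lia.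
split; first exact: twist_delta_matroid.
move=> _ _ /imsetP[X XD ->] /imsetP[Y YD ->]; have := excD _ _ XD YD.
by have := card_twist A X; have := card_twist A Y; rewrite /same_excess; lia.
Qed.

(** The converse direction: the excess of all lower bases, [b - a], propagates to
    all feasible sets by induction on their size. *)
Lemma excess_const D A a b :
  delta_matroid D ->
  (forall M, M \in feasible (lower_matroid D) ->
    #|M :&: A| = a /\ #|M :\: A| = b) ->
  (forall X, X \in feasible D -> #|X :&: A| = a -> #|X :\: A| = b) ->
  (forall X, X \in feasible D -> #|X :\: A| = b -> #|X :&: A| = a) ->
  forall X, X \in feasible D -> #|X :\: A| + a = b + #|X :&: A|.
Proof.
move=> dmD lowD onA onAc X; have [_ _ exD] := dmD.
have [n] := ubnP #|X|; elim: n X => // n IHn X leXn XD.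
have [M ML subM] := lower_contained dmD XD.
have MD := lower_sub_feasible ML; have [cMA cMAc] := lowD M ML.
have leA : a <= #|X :&: A| by rewrite -cMA subset_leq_card ?setSI.
have leAc : b <= #|X :\: A| by rewrite -cMAc subset_leq_card ?setSD.
(* Since [M] is inside [X], the exchange removes [u] and [v] (possibly equal)
   from [X] and adds nothing; the equation is the induction hypothesis. *)
have drop u : u \in X -> u \notin M -> exists v,
      #|X :\: A| + a + #|[set u; v] :&: A|
      = b + #|X :&: A| + #|[set u; v] :\: A|.
  move=> uX uM.
  have uXM : u \in symdiff X M by rewrite in_symdiff uX (negbTE uM).
  have [v vXM ZD] := exD _ _ XD MD _ uXM.
  have vX : v \in X.
    move: vXM; rewrite in_symdiff; case: (boolP (v \in X)) => //= vX vM.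
    by rewrite (subsetP subM) in vX.
  have subX : [set u; v] \subset X by rewrite subUset !sub1set uX.
  have eZ : symdiff X [set u; v] = X :\: [set u; v].
    by rewrite /symdiff (eqP (_ : [set u; v] :\: X == set0)) ?setU0 ?setD_eq0.
  exists v; have := IHn _ _ ZD; rewrite eZ.
  have ltZ : #|X :\: [set u; v]| < n.
    by rewrite -eZ; apply: leq_trans (card_symdiff_pair uX vX) _; rewrite -ltnS.
  have cI : #|X :&: A| = #|[set u; v] :&: A| + #|(X :\: [set u; v]) :&: A|.
    rewrite -(cardsID [set u; v] (X :&: A)) setIDAC setIAC.
    by rewrite [X :&: _](setIidPr subX).
  have cD : #|X :\: A| = #|[set u; v] :\: A| + #|(X :\: [set u; v]) :\: A|.
    rewrite -(cardsID [set u; v] (X :\: A)) setIDAC (setIidPr subX).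
    by rewrite !setDDl [A :|: _]setUC.
  by move/(_ ltZ); lia.
have pair_card u v : #|[set u; v] :&: A| + #|[set u; v] :\: A| <= 2.
  by rewrite cardsID cards2; case: (_ != _).
have le1 : #|X :\: A| + a <= b + #|X :&: A|.
  have [sub|/subsetPn[u]] := boolP (X :&: A \subset M).
    have eA : #|X :&: A| = a.
      apply/eqP; rewrite eqn_leq leA andbT -cMA subset_leq_card //.
      by rewrite subsetI sub subsetIr.
    by rewrite eA (onA X).
  rewrite inE => /andP[uX uA] uM; have [v] := drop u uX uM.
  have : 0 < #|[set u; v] :&: A|.
    by rewrite card_gt0; apply/set0Pn; exists u; rewrite !inE eqxx uA.
  by have := pair_card u v; lia.
suff le2 : b + #|X :&: A| <= #|X :\: A| + a by apply/eqP; rewrite eqn_leq le1.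
have [sub|/subsetPn[u]] := boolP (X :\: A \subset M).
  have eAc : #|X :\: A| = b.
    apply/eqP; rewrite eqn_leq leAc andbT -cMAc subset_leq_card //.
    by apply/subsetP=> x xX; rewrite inE (subsetP sub) // andbT; case/setDP: xX.
  by rewrite eAc (onAc X).
rewrite inE => /andP[uA uX] uM; have [v] := drop u uX uM.
have : 0 < #|[set u; v] :\: A|.
  by rewrite card_gt0; apply/set0Pn; exists u; rewrite !inE eqxx uA.
by have := pair_card u v; lia.
Qed.

End DeltaMatroids.

Theorem theorem3p5 (T : finType) (D : set_system T) (A : {set T})
  (hD : delta_matroid D) (hA0 : A != set0) (hA : A \proper ground D) :
  matroid (twist D A) <->
  (separating (lower_matroid D) A /\
   (matroid (delete_set D A) /\ matroid (delete_set D (ground D :\: A)))).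
Proof.
have [wfD prD _] := hD.
have subA := proper_sub hA.
have lowD := @lower_sub_feasible T D.
rewrite twist_matroid // separatingP //; last first.
- exact: lower_card.
- exact: lower_delta_matroid.
rewrite !delete_set_erase // !erase_matroid //; split=> [excD | [sepA [mA mAc]]].
  split=> [X Y XL YL|].
    have := lower_card XL YL; have := excD _ _ (lowD _ XL) (lowD _ YL).
    by rewrite /same_excess -(cardsID A X) -(cardsID A Y); lia.
  split=> X Y minX minY; have := minimal_on_card minX minY.
    have [[XD _] [YD _]] := (minimal_onP _ _ _ minX, minimal_onP _ _ _ minY).
    by have := excD _ _ XD YD; rewrite /same_excess; lia.
  have [[XD _] [YD _]] := (minimal_onP _ _ _ minX, minimal_onP _ _ _ minY).
  rewrite !setI_compl ?setD_compl ?wfD //.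
  by have := excD _ _ XD YD; rewrite /same_excess; lia.
have [X0 X0D] := set0Pn _ prD; have [M ML _] := lower_contained hD X0D.
have MD := lowD _ ML.
have lowc N : N \in feasible (lower_matroid D) ->
    #|N :&: A| = #|M :&: A| /\ #|N :\: A| = #|M :\: A|.
  move=> NL; have eA := sepA _ _ NL ML; split=> //.
  by have := lower_card NL ML; rewrite -(cardsID A N) -(cardsID A M); lia.
have above X : X \in feasible D ->
    #|M :&: A| <= #|X :&: A| /\ #|M :\: A| <= #|X :\: A|.
  move=> XD; have [N NL sN] := lower_contained hD XD; have [<- <-] := lowc N NL.
  by rewrite !subset_leq_card ?setSI ?setSD.
have minMA : minimal_on D A M.
  by apply/minimal_onP; split=> // X /above[].
have minMAc : minimal_on D (ground D :\: A) M.
  apply/minimal_onP; split=> // X XD.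
  by rewrite !setI_compl ?wfD //; case: (above X).
have exc : forall X, X \in feasible D ->
    #|X :\: A| + #|M :&: A| = #|M :\: A| + #|X :&: A|.
  apply: (excess_const hD lowc) => X XD eX.
    by apply: mA => //; apply: minimal_on_eq minMA XD _; rewrite eX.
  have minX : minimal_on D (ground D :\: A) X.
    apply: (minimal_on_eq minMAc XD).
    by rewrite !setI_compl ?wfD // eX.
  by have := mAc _ _ minX minMAc; rewrite !setD_compl ?wfD.
move=> X Y XD YD; have := exc _ XD; have := exc _ YD.
by rewrite /same_excess; lia.
Qed.
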